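(* The Hopf algebra $\mathbf{PM}_k$ is freely generated as an algebra by the elements $\mathbf{E}_M$ (resp. $\mathbf{H}_M$) where the $M$ are connected (resp. anti-connected) $k$-packed matrices.
   Context: Let $\mathbb{K}$ be a field of characteristic zero, $k \geq 1$, $A_k := \{0,1,\dots,k\}$. A $k$-packed matrix of size $n$ is an $n \times n$ matrix with entries in $A_k$ with at least one nonzero entry in each row and each column; $\mathcal{P}_k$ denotes the set of all of them ($\emptyset$ has size $0$). $\mathbf{PM}_k$ is the vector space with basis $(\mathbf{F}_M)_{M \in \mathcal{P}_k}$, with product $\mathbf{F}_{M_1} \cdot \mathbf{F}_{M_2} = \sum_{M \in \mathrm{Sh}_c(M_1,M_2)} \mathbf{F}_M$, where, for $M_1, M_2$ of sizes $n_1, n_2$, $\mathrm{Sh}_c(M_1,M_2)$ is the set of matrices obtained by shuffling the columns of $M_1$ with an $n_2 \times n_1$ zero block placed below it, with the columns of $M_2$ with an $n_1 \times n_2$ zero block placed above it; and with coproduct $\Delta(\mathbf{F}_M) = \sum_{M = [M_1|M_2]} \mathbf{F}_{\operatorname{cp}(M_1)} \otimes \mathbf{F}_{\operatorname{cp}(M_2)}$, the sum over splittings of $M$ into a left block $M_1$ and right block $M_2$ of columns such that the compressions $\operatorname{cp}(M_i)$ (deletion of null rows and columns) are square. For $k$-packed $M_1, M_2$ of sizes $n_1, n_2$, define the over operation $\mathrm{ov}(M_1, M_2) := \begin{pmatrix} M_1 & 0 \\ 0 & M_2 \end{pmatrix}$ and the under operation $\mathrm{un}(M_1,M_2) := \begin{pmatrix}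 0 & M_1 \\ M_2 & 0 \end{pmatrix}$ (zero blocks of sizes $n_1\times n_2$ and $n_2 \times n_1$). A $k$-packed matrix $M \ne \emptyset$ is connected (resp. anti-connected) if $M = \mathrm{ov}(M_1,M_2)$ (resp. $M = \mathrm{un}(M_1,M_2)$) with $M_1, M_2$ $k$-packed implies $M_1 = M$ or $M_2 = M$. Define a relation $\to$ on $k$-packed matrices of size $n$: $M_1 \to M_2$ if there is $i \in [n-1]$ such that, with $s$ the number of $0$ ending the $i$th column of $M_1$ and $p$ the number of $0$ starting its $(i+1)$st column, $s + p \geq n$ and $M_2$ is obtained from $M_1$ by exchanging its $i$th and $(i+1)$st columns. Let $\leq_{\mathrm{M}}$ be the reflexive and transitive closure of $\to$. Set $\mathbf{E}_M := \sum_{M \leq_{\mathrm{M}} M'} \mathbf{F}_{M'}$ and $\mathbf{H}_M := \sum_{M' \leq_{\mathrm{M}} M} \mathbf{F}_{M'}$ (these are bases of $\mathbf{PM}_k$, and satisfy $\mathbf{E}_{M_1}\cdot\mathbf{E}_{M_2} = \mathbf{E}_{\mathrm{ov}(M_1,M_2)}$, $\mathbf{H}_{M_1}\cdot\mathbf{H}_{M_2} = \mathbf{H}_{\mathrm{un}(M_1,M_2)}$). *)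

(* Defs.v *)
From HB Require Import structures.
From mathcomp Require Import all_boot all_order all_algebra all_fingroup.
From mathcomp Require Import finmap.
From mathcomp.multinomials Require Import monalg.

Set Implicit Arguments.
Unset Strict Implicit.
Unset Printing Implicit Defensive.

Import GRing.Theory.
Local Open Scope ring_scope.

Definition rawmat (k : nat) := {n : nat & 'M['I_k.+1]_n}.

Definition rsize k (M : rawmat k) : nat := tag M.

Definition packedb k (M : rawmat k) : bool :=
  let n := tag M in let A := tagged M in
  [forall i : 'I_n, exists j : 'I_n, nat_of_ord (A i j) != 0%N] &&
  [forall j : 'I_n, exists i : 'I_n, nat_of_ord (A i j) != 0%N].

Definition pk (k : nat) := {M : rawmat k | packedb M}.

Definition pk_empty (k : nat) : rawmat k := Tagged (fun n => 'M['I_k.+1]_n) (0 : 'M['I_k.+1]_0).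

Definition ov k (M1 M2 : rawmat k) : rawmat k :=
  Tagged (fun n => 'M['I_k.+1]_n)
    (block_mx (tagged M1) 0 0 (tagged M2) : 'M['I_k.+1]_(tag M1 + tag M2)).
Definition un k (M1 M2 : rawmat k) : rawmat k :=
  Tagged (fun n => 'M['I_k.+1]_n)
    (castmx (erefl, addnC (tag M2) (tag M1))
       (block_mx 0 (tagged M1) (tagged M2) 0) : 'M['I_k.+1]_(tag M1 + tag M2)).

Definition connected k (M : pk k) : Prop :=
  (0 < rsize (val M))%N /\
  forall M1 M2 : pk k, val M = ov (val M1) (val M2) -> M1 = M \/ M2 = M.

Definition anticonnected k (M : pk k) : Prop :=
  (0 < rsize (val M))%N /\
  forall M1 M2 : pk k, val M = un (val M1) (val M2) -> M1 = M \/ M2 = M.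

Definition PM (K : fieldType) (k : nat) := {malg K[pk k]}.

(* F_N for a raw matrix N (zero if N is not packed; only used on packed N) *)
Definition Fraw (K : fieldType) k (N : rawmat k) : PM K k :=
  if insub N is Some M then << M >> else 0.

Definition shufflep n1 n2 (s : 'S_(n1 + n2)) : bool :=
  [forall j : 'I_(n1 + n2), forall j' : 'I_(n1 + n2),
    ((j < j')%N && ((s j < n1)%N == (s j' < n1)%N)) ==> (s j < s j')%N].

Definition shc k (M1 M2 : rawmat k) : seq (rawmat k) :=
  let A := row_mx (col_mx (tagged M1) 0) (col_mx 0 (tagged M2))
           : 'M['I_k.+1]_(tag M1 + tag M2) in
  undup [seq Tagged (fun n => 'M['I_k.+1]_n) (col_perm s A)
        | s <- enum [pred s : 'S_(tag M1 + tag M2) | shufflep s]].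

Definition mulPM (K : fieldType) k (x y : PM K k) : PM K k :=
  \sum_(M1 <- msupp x) \sum_(M2 <- msupp y)
     (x@_M1 * y@_M2) *: \sum_(N <- shc (val M1) (val M2)) Fraw K N.

Definition onePM (K : fieldType) k : PM K k := Fraw K (pk_empty k).

Definition colseq k n (A : 'M['I_k.+1]_n) (j : 'I_n) : seq nat :=
  [seq nat_of_ord (A r j) | r <- enum 'I_n].
Definition lead0 k n (A : 'M['I_k.+1]_n) j : nat :=
  find (fun x => x != 0%N) (colseq A j).
Definition trail0 k n (A : 'M['I_k.+1]_n) j : nat :=
  find (fun x => x != 0%N) (rev (colseq A j)).

Definition arrow k n (A B : 'M['I_k.+1]_n) : bool :=
  [exists i : 'I_n, exists j : 'I_n, [&& nat_of_ord j == i.+1,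
     (n <= trail0 A i + lead0 A j)%N &
     B == xcol i j A]].

Definition leM k n (A B : 'M['I_k.+1]_n) : bool := connect (@arrow k n) A B.

Definition EPM (K : fieldType) k (M : pk k) : PM K k :=
  \sum_(B : 'M['I_k.+1]_(tag (val M)) | leM (tagged (val M)) B)
     Fraw K (Tagged (fun n => 'M['I_k.+1]_n) B).

Definition HPM (K : fieldType) k (M : pk k) : PM K k :=
  \sum_(B : 'M['I_k.+1]_(tag (val M)) | leM B (tagged (val M)))
     Fraw K (Tagged (fun n => 'M['I_k.+1]_n) B).

Definition monom (K : fieldType) k (G : pk k -> PM K k) (w : seq (pk k)) : PM K k :=
  foldr (@mulPM K k) (onePM K k) (map G w).

(* "PM_k is freely generated as an algebra by the G_M, M satisfying P":
   the noncommutative monomials in these generators form a basis. *)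
Definition freely_generated (K : fieldType) k (G : pk k -> PM K k)
    (P : pk k -> Prop) : Prop :=
  (forall x : PM K k, exists (s : seq (seq (pk k))) (c : seq (pk k) -> K),
      (forall w, w \in s -> forall M, M \in w -> P M) /\
      x = \sum_(w <- s) c w *: monom G w) /\
  (forall (s : seq (seq (pk k))) (c : seq (pk k) -> K),
      uniq s -> (forall w, w \in s -> forall M, M \in w -> P M) ->
      \sum_(w <- s) c w *: monom G w = 0 -> forall w, w \in s -> c w = 0).

(* Main.v *)
(** The multiplication rule E_M . E_N = E_ov(M,N) turns a word in the E_M, with M
connected, into E of an iterated over-product. Factorization of packed matrices
into connected ones for the over operation is unique, so such words are indexed
bijectively by all packed matrices. Finally the E_M form a basis because they are
unitriangular: each arrow strictly decreases the weight sum_j j * (number of zeros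
starting column j). The H case follows from the E case by reversing columns. *)

Require Import Defs.
From HB Require Import structures.
From mathcomp Require Import all_boot all_order all_algebra all_fingroup.
From mathcomp Require Import finmap zify.
From mathcomp.multinomials Require Import monalg.
From Stdlib Require Import Classical_Prop.

Set Implicit Arguments.
Unset Strict Implicit.
Unset Printing Implicit Defensive.

Import GRing.Theory.
Local Open Scope ring_scope.

(** * Adjacent column exchanges *)

(** The multiplication rule for the E family is proved here from a description of upper intervals:
    the matrices above [dsum A X] form the disjoint union, over [B] above [A] and [Y] above [X], of
    the column shuffles of [B] and [Y]. Disjointness rests on nonnull columns, since the row of a
    nonzero entry reveals which block its column comes from. Sizes are dependent indices, so the
    order is studied at a fixed size, while associativity and cancellation for [ov] are checked on
    entries indexed by [nat]. *)

Lemma sum_tperm_lt n (f : 'I_n -> nat) (i j : 'I_n) :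
  j = i.+1 :> nat -> (f i < f j)%N ->
  (\sum_(x < n) x * f (tperm i j x) < \sum_(x < n) x * f x)%N.
Proof.
move=> ji fij; have nij : j != i by rewrite -val_eqE /= ji; lia.
(* Only the terms at [i] and [i + 1] change, and the sum drops by [f j - f i]. *)
have split2 (g : 'I_n -> nat) : (\sum_(x < n) x * g x =
    i * g i + (j * g j + \sum_(x < n | (x != i) && (x != j)) x * g x))%N.
  by rewrite (bigD1 i) //= (bigD1 j).
rewrite (split2 f) (split2 (fun x => f (tperm i j x))) tpermL tpermR.
under eq_bigr => x /andP[xi xj] do rewrite tpermD 1?eq_sym //.
by rewrite ji; move: (\sum_(x < n | _) _)%N (nat_of_ord i) (f i) (f j) fij => S a b c; nia.
Qed.

Section Matrices.
Variable k : nat.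
Implicit Types n : nat.
Local Notation mat n := 'M['I_k.+1]_n.

Lemma size_colseq n (A : mat n) j : size (colseq A j) = n.
Proof. by rewrite size_map size_enum_ord. Qed.

Lemma nth_colseq n (A : mat n) (j r : 'I_n) :
  nth 0%N (colseq A j) r = A r j.
Proof. by rewrite (nth_map r) ?size_enum_ord // nth_ord_enum. Qed.

Lemma lead0_le n (A : mat n) (j r : 'I_n) :
  A r j != 0 -> (lead0 A j <= r)%N.
Proof.
move=> Ar; rewrite leqNgt; apply/negP => /(before_find 0%N).
by rewrite nth_colseq; move: Ar; rewrite -val_eqE /= => ->.
Qed.

Lemma lead0_lt n (A : mat n) (j : 'I_n) :
  (lead0 A j < n)%N -> exists2 r : 'I_n, r = lead0 A j :> nat & A r j != 0.
Proof.
move=> lt; exists (Ordinal lt) => //.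
have : has (fun x => x != 0%N) (colseq A j) by rewrite has_find size_colseq.
by move/(nth_find 0%N); rewrite -[find _ _]/(nat_of_ord (Ordinal lt)) nth_colseq.
Qed.

Lemma nth_rev_colseq n (A : mat n) (j r : 'I_n) :
  nth 0%N (rev (colseq A j)) r = A (rev_ord r) j.
Proof. by rewrite nth_rev size_colseq // -[(n - _)%N]/(val (rev_ord r)) nth_colseq. Qed.

Lemma trail0_le n (A : mat n) (j r : 'I_n) :
  A r j != 0 -> (trail0 A j <= rev_ord r)%N.
Proof.
move=> Ar; rewrite leqNgt; apply/negP => /(before_find 0%N).
by rewrite nth_rev_colseq rev_ordK; move: Ar; rewrite -val_eqE => ->.
Qed.

Lemma trail0_lt n (A : mat n) (j : 'I_n) :
  (trail0 A j < n)%N ->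
  exists2 r : 'I_n, rev_ord r = trail0 A j :> nat & A r j != 0.
Proof.
move=> lt; exists (rev_ord (Ordinal lt)); first by rewrite rev_ordK.
have : has (fun x => x != 0%N) (rev (colseq A j)).
  by rewrite has_find size_rev size_colseq.
by move/(nth_find 0%N); rewrite -[find _ _]/(nat_of_ord (Ordinal lt)) nth_rev_colseq.
Qed.

Lemma lead0_max n (A : mat n) j : (lead0 A j <= n)%N.
Proof. by rewrite -[X in (_ <= X)%N](size_colseq A j) find_size. Qed.

Lemma trail0_max n (A : mat n) j : (trail0 A j <= n)%N.
Proof. by rewrite -[X in (_ <= X)%N](size_colseq A j) -size_rev find_size. Qed.

Definition separated n (A : mat n) (i j : 'I_n) : Prop :=
  forall r r', A r i != 0 -> A r' j != 0 -> (r < r')%N.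

(** The last nonzero row of column [i] is [n - 1 - trail0 A i], the first of column [j] is
    [lead0 A j]. If one of the columns is null, [find] returns [n] and both sides hold. *)
Lemma separatedP n (A : mat n) (i j : 'I_n) :
  reflect (separated A i j) (n <= trail0 A i + lead0 A j)%N.
Proof.
apply: (iffP idP) => [le r r' /trail0_le /= tr /lead0_le ld | sepA].
  by have := ltn_ord r; lia.
have := lead0_max A j; rewrite leq_eqVlt => /orP[/eqP|/lead0_lt[r' r'E Ar']].
  by lia.
have := trail0_max A i; rewrite leq_eqVlt => /orP[/eqP|/trail0_lt[r rE Ar]].
  by lia.
by have := sepA _ _ Ar Ar'; move: rE => /=; have := ltn_ord r; lia.
Qed.

Lemma col_permEp n (s : 'S_n) (A : mat n) r c : col_perm s A r c = A r (s c).
Proof. by rewrite mxE. Qed.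

Lemma arrowP n (A B : mat n) :
  reflect (exists i j : 'I_n,
    [/\ j = i.+1 :> nat, separated A i j & B = col_perm (tperm i j) A])
    (arrow A B).
Proof.
apply: (iffP existsP) => [[i /existsP[j /and3P[/eqP ji /separatedP s /eqP ->]]]|].
  by exists i, j.
move=> [i [j [ji s ->]]]; exists i; apply/existsP; exists j.
by rewrite ji eqxx /=; apply/andP; split=> //; apply/separatedP.
Qed.

Definition nzcols n (A : mat n) : Prop := forall j, exists i, A i j != 0.

Lemma nzcols_perm n (s : 'S_n) (A : mat n) : nzcols A -> nzcols (col_perm s A).
Proof. by move=> nzA j; have [i Ai] := nzA (s j); exists i; rewrite mxE. Qed.

Lemma leM_nzcols n (A B : mat n) : leM A B -> nzcols A -> nzcols B.
Proof.
move=> /connectP[p]; elim: p A => [|C p IH] A /=; first by move=> _ ->.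
case/andP=> /arrowP[i [j [_ _ ->]]] pth lst nzA.
exact: IH _ pth lst (nzcols_perm _ nzA).
Qed.

(* An arrow exchanges two adjacent columns with increasing [lead0], so this weight
   strictly decreases along arrows. *)
Definition colweight n (A : mat n) : nat := (\sum_(j < n) j * lead0 A j)%N.

Lemma lead0_col_perm n (s : 'S_n) (A : mat n) j :
  lead0 (col_perm s A) j = lead0 A (s j).
Proof.
rewrite /lead0; congr find; rewrite /colseq; apply: eq_map => r.
by rewrite mxE.
Qed.

Lemma arrow_colweight n (A B : mat n) :
  nzcols A -> arrow A B -> (colweight B < colweight A)%N.
Proof.
move=> nzA /arrowP[i [j [ji s ->]]]; rewrite /colweight.
under eq_bigr do rewrite lead0_col_perm.
apply: (@sum_tperm_lt _ (lead0 A)) => //.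
have [r0 /lead0_le r0P] := nzA i.
have /lead0_lt[r rE Ar] : (lead0 A i < n)%N by have := ltn_ord r0; lia.
(* A null column [j] has [lead0] equal to [n], still above the value for the nonnull column [i]. *)
have := lead0_max A j; rewrite leq_eqVlt => /orP[/eqP|/lead0_lt[r' r'E Ar']].
  by have := ltn_ord r; lia.
by rewrite -rE -r'E; apply: s.
Qed.

Lemma leM_colweight n (A B : mat n) :
  nzcols A -> leM A B -> B = A \/ (colweight B < colweight A)%N.
Proof.
move=> nzA /connectP[p]; elim: p A nzA => [|C p IH] A nzA /=.
  by move=> _ ->; left.
case/andP=> AC pth lst; right.
have lt := arrow_colweight nzA AC.
have nzC : nzcols C by apply: leM_nzcols nzA; apply: connect1.
case: (IH _ nzC pth lst) => [-> //|lt']; exact: ltn_trans lt' lt.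
Qed.

Lemma leM_refl n (A : mat n) : leM A A. Proof. exact: connect0. Qed.
Lemma leM_trans n (A B C : mat n) : leM A B -> leM B C -> leM A C.
Proof. exact: connect_trans. Qed.

End Matrices.

(** * Shuffles of columns *)

(** A value in ['I_n] is the number of values below it, so a permutation is determined by the
    comparisons between its values. *)
Lemma perm_rank n (s : 'S_n) j : s j = #|[set x | (s x < s j)%N]| :> nat.
Proof.
have -> : [set x | (s x < s j)%N] = s @^-1: [set y : 'I_n | (y < s j)%N].
  by apply/setP => x; rewrite !inE.
rewrite card_preimset; last exact: perm_inj.
rewrite cardsE -sum1_card -(big_ord_widen _ (fun=> 1%N)) ?sum1_card ?card_ord //.
exact: ltnW.
Qed.

(** Increase at neighbours propagates to all pairs, so ranks agree with those of the identity. The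
    contrapositive supplies the descent undone in [shuffle_leM]. *)
Lemma perm_incr_id n (s : 'S_n) :
  (forall i j : 'I_n, j = i.+1 :> nat -> (s i < s j)%N) -> s = 1%g.
Proof.
move=> incr.
have mono d (i j : 'I_n) : j = (i + d).+1 :> nat -> (s i < s j)%N.
  elim: d j => [|d IH] j ji; first by apply: incr; rewrite ji addn0.
  have lt : ((i + d).+1 < n)%N by have := ltn_ord j; lia.
  apply: (@ltn_trans (s (Ordinal lt))); first exact: IH.
  by apply: incr; rewrite ji /=; lia.
have mono2 i j : (s i < s j)%N = (i < j)%N.
  case: (ltngtP i j) => [ij|ji|/val_inj ->]; last by rewrite ltnn.
    by rewrite (mono (j - i.+1)%N) //; lia.
  by apply/negbTE; rewrite -leqNgt ltnW // (mono (i - j.+1)%N) //; lia.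
apply/permP => j; apply: val_inj; rewrite perm1 /= perm_rank.
rewrite -[in RHS](perm1 j) [RHS]perm_rank; congr #|pred_of_set _|.
by apply/setP => x; rewrite !inE !perm1 mono2.
Qed.

Section Shuffles.
Variables n1 n2 : nat.
Implicit Types s t : 'S_(n1 + n2).

(** [col_perm s] puts the source column [s j] at position [j], so [s j < n1] says that this column
    comes from the first matrix. *)
Lemma shufflepP s :
  reflect (forall j j' : 'I_(n1 + n2), (j < j')%N ->
             (s j < n1)%N = (s j' < n1)%N -> (s j < s j')%N)
          (@shufflep n1 n2 s).
Proof.
apply: (iffP forallP) => [sh j j' jj' sj|sh j].
  by move: (sh j) => /forallP/(_ j'); rewrite jj' sj eqxx.
by apply/forallP => j'; apply/implyP => /andP[jj' /eqP]; apply: sh.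
Qed.

(** Comparisons between values of a shuffle depend only on its pattern of blocks. With [perm_rank],
    the pattern therefore determines the shuffle. *)
Lemma shuffle_lt s x j : @shufflep n1 n2 s ->
  (s x < s j)%N =
  if (s x < n1)%N == (s j < n1)%N then (x < j)%N else (s x < n1)%N.
Proof.
move=> /shufflepP sh; case: eqP => [e|]; last by lia.
case: (ltngtP x j) => [xj|jx|/val_inj ->]; last by rewrite ltnn.
  exact: sh.
by apply/negbTE; rewrite -leqNgt ltnW // sh.
Qed.

Lemma shuffle_inj s t : @shufflep n1 n2 s -> @shufflep n1 n2 t ->
  (forall j, (s j < n1)%N = (t j < n1)%N) -> s = t.
Proof.
move=> sh th st; apply/permP => j; apply: val_inj.
rewrite /= perm_rank [RHS]perm_rank; congr #|pred_of_set _|.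
by apply/setP => x; rewrite !inE !shuffle_lt // !st.
Qed.

(** The only pair of positions whose order changes is [(i, j)], and its columns belong to different
    blocks. *)
Lemma shuffle_swap s (i j : 'I_(n1 + n2)) : j = i.+1 :> nat ->
  (s i < n1)%N != (s j < n1)%N -> @shufflep n1 n2 s ->
  @shufflep n1 n2 (tperm i j * s)%g.
Proof.
move=> ji nij /shufflepP sh; apply/shufflepP => x y xy; rewrite !permM => e.
apply: sh => //; move: xy e.
case: tpermP => [->|->|xi xj]; case: tpermP => [->|->|yi yj];
  rewrite ?ltnn //; try lia.
- by move=> iy _; move/eqP: yj; rewrite -val_eqE /=; lia.
- by move=> xj' _; move/eqP: xi; rewrite -val_eqE /=; lia.
Qed.

Lemma shuffle1 : @shufflep n1 n2 1%g.
Proof. by apply/shufflepP => j j' jj' _; rewrite !perm1. Qed.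

End Shuffles.

(** * Upper intervals of block-diagonal matrices *)

Section DirectSum.
Variables k n1 n2 : nat.
Local Notation mat n := 'M['I_k.+1]_n.

(** The matrix inside [ov], at an explicit size so that column permutations apply to it. By
    [block_mxEh] it is also the matrix whose columns [shc] shuffles, which links the over operation
    to the product. *)
Definition dsum (B : mat n1) (Y : mat n2) : mat (n1 + n2) :=
  block_mx B 0 0 Y.

Implicit Types (A B : mat n1) (X Y : mat n2) (C : mat (n1 + n2)).

Lemma dsum_neq0 B Y r c :
  dsum B Y r c != 0 -> (r < n1)%N = (c < n1)%N.
Proof.
case: (split_ordP r) => r0 ->; case: (split_ordP c) => c0 ->;
  rewrite /dsum ?block_mxEul ?block_mxEur ?block_mxEdl ?block_mxEdr //=
    ?mxE ?eqxx //; by have := ltn_ord r0; have := ltn_ord c0; lia.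
Qed.

Lemma nzcols_dsum B Y : nzcols B -> nzcols Y -> nzcols (dsum B Y).
Proof.
move=> z1 z2 c; case: (split_ordP c) => c0 ->.
  by have [r ?] := z1 c0; exists (lshift n2 r); rewrite block_mxEul.
by have [r ?] := z2 c0; exists (rshift n1 r); rewrite block_mxEdr.
Qed.

Lemma separated_dsuml B Y i j :
  separated (dsum B Y) (lshift n2 i) (lshift n2 j) <-> separated B i j.
Proof.
split=> sep r r'.
  by move=> Br Br'; apply: (sep (lshift n2 r) (lshift n2 r')); rewrite block_mxEul.
case: (split_ordP r) => r0 ->; case: (split_ordP r') => r0' ->;
  rewrite /dsum ?block_mxEul ?block_mxEdl ?mxE ?eqxx //; exact: sep.
Qed.

Lemma separated_dsumr B Y i j :
  separated (dsum B Y) (rshift n1 i) (rshift n1 j) <-> separated Y i j.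
Proof.
split=> sep r r'.
  move=> Br Br'; rewrite -(ltn_add2l n1).
  by apply: (sep (rshift n1 r) (rshift n1 r')); rewrite block_mxEdr.
case: (split_ordP r) => r0 ->; case: (split_ordP r') => r0' ->;
  rewrite /dsum ?block_mxEur ?block_mxEdr ?mxE ?eqxx //= ltn_add2l; exact: sep.
Qed.

Lemma col_perm_dsuml B Y i j :
  col_perm (tperm (lshift n2 i) (lshift n2 j)) (dsum B Y) =
  dsum (col_perm (tperm i j) B) Y.
Proof.
apply/matrixP => r c; rewrite mxE.
case: (split_ordP c) => c0 ->.
  rewrite -(inj_tperm _ _ _ (@lshift_inj n1 n2)).
  by case: (split_ordP r) => r0 ->; rewrite /dsum ?block_mxEul ?block_mxEdl !mxE.
rewrite tpermD ?eq_lrshift //.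
by case: (split_ordP r) => r0 ->; rewrite /dsum ?block_mxEur ?block_mxEdr.
Qed.

Lemma col_perm_dsumr B Y i j :
  col_perm (tperm (rshift n1 i) (rshift n1 j)) (dsum B Y) =
  dsum B (col_perm (tperm i j) Y).
Proof.
apply/matrixP => r c; rewrite mxE.
case: (split_ordP c) => c0 ->; last first.
  rewrite -(inj_tperm _ _ _ (@rshift_inj n1 n2)).
  by case: (split_ordP r) => r0 ->; rewrite /dsum ?block_mxEur ?block_mxEdr !mxE.
rewrite tpermD ?eq_rlshift //.
by case: (split_ordP r) => r0 ->; rewrite /dsum ?block_mxEul ?block_mxEdl.
Qed.

Lemma leM_dsuml A B Y : leM A B -> leM (dsum A Y) (dsum B Y).
Proof.
case/connectP=> p; elim: p A => [|C p IH] A /=; first by move=> _ ->; apply: leM_refl.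
case/andP=> /arrowP[i [j [ji s eC]]] pth lst; apply: leM_trans (IH _ pth lst).
apply: connect1; apply/arrowP; exists (lshift n2 i), (lshift n2 j).
by rewrite eC col_perm_dsuml; split=> //; apply/separated_dsuml.
Qed.

Lemma leM_dsumr B X Y : leM X Y -> leM (dsum B X) (dsum B Y).
Proof.
case/connectP=> p; elim: p X => [|C p IH] X /=; first by move=> _ ->; apply: leM_refl.
case/andP=> /arrowP[i [j [ji s eC]]] pth lst; apply: leM_trans (IH _ pth lst).
apply: connect1; apply/arrowP; exists (rshift n1 i), (rshift n1 j).
rewrite eC col_perm_dsumr; split=> //; last exact/separated_dsumr.
by rewrite /= ji addnS.
Qed.

Definition is_shuffle B Y C : bool :=
  [exists s : 'S_(n1 + n2), @shufflep n1 n2 s && (C == col_perm s (dsum B Y))].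

Lemma is_shuffleP B Y C :
  reflect (exists2 s, @shufflep n1 n2 s & C = col_perm s (dsum B Y))
          (is_shuffle B Y C).
Proof.
apply: (iffP existsP) => [[s /andP[sh /eqP ->]]|[s sh ->]]; first by exists s.
by exists s; rewrite sh eqxx.
Qed.

(* The pattern of top and bottom columns determines the shuffle. *)
Lemma is_shuffle_inj B Y B' Y' C : nzcols B -> nzcols Y ->
  is_shuffle B Y C -> is_shuffle B' Y' C -> B = B' /\ Y = Y'.
Proof.
move=> z1 z2 /is_shuffleP[s sh ->] /is_shuffleP[t th e].
have st : s = t.
  apply: (shuffle_inj sh th) => j.
  have [r nz] := nzcols_dsum z1 z2 (s j).
  rewrite -(dsum_neq0 nz); apply: (dsum_neq0 (B := B') (Y := Y')).
  by move/matrixP/(_ r j): e; rewrite !col_permEp => <-.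
move: e; rewrite -st => /(congr1 (col_perm s^-1)).
by rewrite -!col_permM mulVg !col_perm1 => /eq_block_mx[].
Qed.

(** Bubble sort: a nontrivial shuffle has a descent at neighbouring positions. Undoing it gives a
    shuffle closer to the identity, from which one arrow leads back. *)
Lemma shuffle_leM B Y s : nzcols B -> nzcols Y -> @shufflep n1 n2 s ->
  leM (dsum B Y) (col_perm s (dsum B Y)).
Proof.
(* [rev_ord] turns a descent of [s] into the increase required by [sum_tperm_lt]. *)
move=> z1 z2; have [m] := ubnP (\sum_(x < n1 + n2) x * rev_ord (s x))%N.
elim: m s => // m IH s lt sh.
have [s1|ns1] := eqVneq s 1%g; first by rewrite s1 col_perm1 leM_refl.
have [i [j [ji sji]]] : exists i j : 'I_(n1 + n2), j = i.+1 :> nat /\ (s j < s i)%N.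
  have [/existsP[i /existsP[j /andP[/eqP ji sij]]]|] :=
    boolP [exists i : 'I_(n1 + n2), exists j : 'I_(n1 + n2),
      (j == i.+1 :> nat) && (s j < s i)%N]; first by exists i, j.
  rewrite negb_exists => /forallP no; case/eqP: ns1; apply: perm_incr_id => i j ji.
  move: (no i); rewrite negb_exists => /forallP/(_ j).
  rewrite ji eqxx /= -leqNgt leq_eqVlt => /orP[/eqP/val_inj/perm_inj e|//].
  by move: ji; rewrite e; lia.
(* A shuffle increases inside each block, so the descent has a bottom column followed by a top one.
   Once exchanged, they are separated by the boundary between the blocks of rows. *)
have nblk : (s i < n1)%N != (s j < n1)%N.
  apply/negP => /eqP e; move: sji.
  by rewrite (shuffle_lt _ _ sh) e eqxx ji; lia.
have sj : (s j < n1)%N by move: nblk; lia.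
have si : (n1 <= s i)%N by move: nblk; lia.
apply: leM_trans (IH (tperm i j * s)%g _ (shuffle_swap ji nblk sh)) _.
  rewrite -ltnS; apply: leq_trans lt; rewrite ltnS.
  under eq_bigr do rewrite permM.
  apply: (@sum_tperm_lt _ (fun x => rev_ord (s x) : nat)) => //=.
  by have := ltn_ord (s i); lia.
apply: connect1; apply/arrowP; exists i, j; split=> //.
  move=> r r'; rewrite !col_permEp !permM tpermL tpermR.
  by move=> /dsum_neq0 e1 /dsum_neq0 e2; lia.
by rewrite !col_permM -col_permM tperm2 col_perm1.
Qed.

(** The set of such shuffles is stable under arrows. An exchange across blocks changes only the
    shuffle, and an exchange within a block is an arrow of [B] or of [Y]. *)
Lemma leM_dsumP A X C : nzcols A -> nzcols X ->
  leM (dsum A X) C <->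
  exists B Y, [/\ leM A B, leM X Y & is_shuffle B Y C].
Proof.
move=> z1 z2; split; last first.
  move=> [B [Y [l1 l2 /is_shuffleP[s sh ->]]]].
  apply: leM_trans (leM_dsuml _ l1) _; apply: leM_trans (leM_dsumr _ l2) _.
  by apply: shuffle_leM sh; apply: leM_nzcols; eassumption.
have base : exists B Y, [/\ leM A B, leM X Y & is_shuffle B Y (dsum A X)].
  exists A, X; split; try exact: leM_refl.
  by apply/is_shuffleP; exists 1%g; rewrite ?shuffle1 ?col_perm1.
case/connectP=> p; elim: p (dsum A X) base => [|C' p IH] D base /=.
  by move=> _ ->.
case/andP=> /arrowP[i [j [ji sep eC]]] pth lst; apply: IH pth lst.
case: base => B [Y [l1 l2 /is_shuffleP[s sh eD]]].
have nz : nzcols (dsum B Y).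
  by apply: nzcols_dsum; [apply: leM_nzcols l1 z1|apply: leM_nzcols l2 z2].
have sep' : separated (dsum B Y) (s i) (s j).
  by move=> r r' nr nr'; apply: sep; rewrite eD col_permEp.
(* Exchanging two positions after the shuffle amounts to exchanging their source columns before
   it. *)
have ts : (tperm i j * s = s * tperm (s i) (s j))%g.
  by apply/permP => x; rewrite !permM inj_tperm //; apply: perm_inj.
have [e|nblk] := eqVneq (s i < n1)%N (s j < n1)%N; last first.
  exists B, Y; split=> //; apply/is_shuffleP; exists (tperm i j * s)%g.
    exact: shuffle_swap.
  by rewrite eC eD -col_permM.
(* A source column strictly between the two would lie in the same block, hence at a position
   strictly between [i] and [i + 1]. *)
have adj : s j = (s i).+1 :> nat.
  have lt : (s i < s j)%N by rewrite shuffle_lt // e eqxx ji.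
  apply/eqP; rewrite eqn_leq lt andbT leqNgt; apply/negP => lt2.
  have bnd : ((s i).+1 < n1 + n2)%N by have := ltn_ord (s j); lia.
  pose y := (s^-1)%g (Ordinal bnd).
  have sy : s y = (s i).+1 :> nat by rewrite /y permKV.
  have b1 : (s y < n1)%N = (s i < n1)%N by lia.
  have := shuffle_lt i y sh; have := shuffle_lt y j sh.
  by rewrite b1 e eqxx sy ltnSn lt2 ji; lia.
case: (split_ordP (s i)) => a ea; case: (split_ordP (s j)) => b eb;
  move: e sep' adj ts; rewrite ea eb /= => e sep' adj ts.
- exists (col_perm (tperm a b) B), Y; split=> //.
    apply: leM_trans l1 _; apply: connect1; apply/arrowP; exists a, b; split=> //.
    exact: (separated_dsuml B Y a b).1 sep'.
  apply/is_shuffleP; exists s => //.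
  by rewrite -col_perm_dsuml eC eD -!col_permM ts.
- by exfalso; have := ltn_ord a; lia.
- by exfalso; have := ltn_ord b; lia.
- exists B, (col_perm (tperm a b) Y); split=> //.
    apply: leM_trans l2 _; apply: connect1; apply/arrowP; exists a, b; split=> //.
    by lia.
    exact: (separated_dsumr B Y a b).1 sep'.
  apply/is_shuffleP; exists s => //.
  by rewrite -col_perm_dsumr eC eD -!col_permM ts.
Qed.

(** By [leM_dsumP] the shuffles cover the upper interval, and by [is_shuffle_inj] each matrix arises
    from a single pair [(B, Y)]. *)
Lemma sum_leM_dsum (V : nmodType) (F : mat (n1 + n2) -> V) A X :
  nzcols A -> nzcols X ->
  \sum_(C | leM (dsum A X) C) F C =
  \sum_(B | leM A B) \sum_(Y | leM X Y) \sum_(C | is_shuffle B Y C) F C.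
Proof.
move=> z1 z2; rewrite pair_big /=.
rewrite (exchange_big_dep (fun C => leM (dsum A X) C)) /=; last first.
  move=> [B Y] C /andP[l1 l2] sh; apply/leM_dsumP => //.
  by exists B, Y.
apply: eq_bigr => C /leM_dsumP -/(_ z1 z2)[B [Y [l1 l2 sh]]].
rewrite (big_pred1 (B, Y)) // => -[B' Y'] /=; apply/idP/eqP.
  case/andP=> /andP[l1' l2'] sh'.
  by have [||-> ->] := is_shuffle_inj _ _ sh' sh; try exact: leM_nzcols z1; try exact: leM_nzcols z2.
by case=> -> ->; rewrite l1 l2 sh.
Qed.

End DirectSum.

(** * Triangular families in free modules *)

Section LinearExtension.
Variables (K : fieldType) (T : choiceType).
Implicit Types (V : lmodType K).
Local Notation A := {malg K[T]}.

Definition lext V (f : T -> V) (x : A) : V := \sum_(M <- msupp x) x@_M *: f M.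

(** Enlarging the index set beyond the support lets several elements share it, as linearity
    requires. *)
Lemma lextEw V (f : T -> V) (D : {fset T}) (x : A) :
  (msupp x `<=` D)%fset -> lext f x = \sum_(M <- D) x@_M *: f M.
Proof.
move=> sub; apply: big_fset_incl => // M _ /mcoeff_outdom ->.
by rewrite scale0r.
Qed.

Lemma lext_is_linear V (f : T -> V) : linear (lext f).
Proof.
move=> a x y; pose D := (msupp (a *: x + y)%R `|` (msupp x `|` msupp y))%fset.
rewrite (@lextEw _ _ D) ?fsubsetUl // (@lextEw _ _ D x); last first.
  by rewrite fsubsetU // fsubsetUl orbT.
rewrite (@lextEw _ _ D y); last by rewrite fsubsetU // fsubsetUr orbT.
rewrite scaler_sumr -big_split /=; apply: eq_bigr => M _.
by rewrite mcoeffD mcoeffZ scalerDl scalerA.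
Qed.

HB.instance Definition _ V (f : T -> V) :=
  GRing.isLinear.Build K A V *:%R (lext f) (lext_is_linear f).

Lemma lextU V (f : T -> V) M : lext f << M >> = f M.
Proof. by rewrite (lextEw _ msuppU_le) big_seq_fset1 mcoeffUU scale1r. Qed.

Lemma malg_lext (x : A) : x = lext (fun M => << M >>) x.
Proof.
rewrite [LHS]monalgE; apply: eq_bigr => M _; apply/malgP => N.
by rewrite mcoeffZ !mcoeffU mulr_natr.
Qed.

Lemma eq_lext V (f g : T -> V) : f =1 g -> lext f =1 lext g.
Proof. by move=> fg x; apply: eq_bigr => M _; rewrite fg. Qed.

Lemma linear_lext V V' (g : {linear V -> V'}) (f : T -> V) x :
  g (lext f x) = lext (fun M => g (f M)) x.
Proof. by rewrite linear_sum; apply: eq_bigr => M _; rewrite linearZ. Qed.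

Lemma lext_lext V (f : T -> V) (h : T -> A) x :
  lext f (lext h x) = lext (fun M => lext f (h M)) x.
Proof. exact: (linear_lext (lext f)). Qed.

End LinearExtension.

Section Triangular.
Variables (K : fieldType) (T : choiceType) (G : T -> {malg K[T]}) (mu : T -> nat).
Hypothesis G_diag : forall M, (G M)@_M = 1.
Hypothesis G_low : forall M N, (G M)@_N != 0 -> N != M -> (mu N < mu M)%N.

(** A list of pairs may repeat an index, so combinations are added by concatenation. *)
Definition spanned (x : {malg K[T]}) : Prop :=
  exists L : seq (K * T), x = \sum_(p <- L) p.1 *: G p.2.

Lemma spanned_sum (I : eqType) (r : seq I) (a : I -> K) F :
  (forall i, i \in r -> spanned (F i)) -> spanned (\sum_(i <- r) a i *: F i).
Proof.
elim: r => [|i r IH] H; first by exists [::]; rewrite !big_nil.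
have [L1 e1] := H i (mem_head _ _).
have [|L2 e2] := IH; first by move=> j jr; apply: H; rewrite inE jr orbT.
exists ([seq (a i * p.1, p.2) | p <- L1] ++ L2).
rewrite big_cons big_cat big_map /=; congr (_ + _); last exact: e2.
by rewrite e1 scaler_sumr; apply: eq_bigr => p _; rewrite scalerA.
Qed.

Lemma triangular_span x : spanned x.
Proof.
rewrite (malg_lext x); apply: spanned_sum => M _.
have [m] := ubnP (mu M); elim: m M => // m IH M; rewrite ltnS => le.
(* [G M] minus its lower terms, written as a two-term combination so that [spanned_sum] applies. *)
have -> : << M >> = \sum_(i <- [:: (1, G M); (-1,
    \sum_(N <- [seq N <- msupp (G M) | N != M]) (G M)@_N *: << N >>)])
    i.1 *: i.2 :> {malg K[T]}.
  rewrite big_cons big_seq1 /= scale1r scaleN1r big_filter.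
  have inM : M \in msupp (G M) by rewrite -mcoeff_neq0 G_diag oner_eq0.
  have := malg_lext (G M); rewrite /lext (bigD1_seq M) //= G_diag scale1r.
  by move=> {1}->; rewrite addrK.
apply: spanned_sum => i; rewrite !inE => /orP[/eqP ->|/eqP ->] /=.
  by exists [:: (1, M)]; rewrite big_seq1 scale1r.
apply: spanned_sum => N; rewrite mem_filter => /andP[NM].
by rewrite -mcoeff_neq0 => nz; apply: IH; apply: leq_trans le; apply: G_low.
Qed.

(** Coefficients vanish from the largest [mu] downwards: at [phi i], the sum has coefficient [c i]
    plus contributions of indices with larger [mu], already known to be zero. The map [phi] allows
    words as indices. *)
Lemma triangular_free (I : eqType) (phi : I -> T) (s : seq I) (c : I -> K) :
  uniq s -> {in s &, injective phi} ->
  \sum_(i <- s) c i *: G (phi i) = 0 -> forall i, i \in s -> c i = 0.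
Proof.
move=> us inj sum0 i; pose b := (\max_(i <- s) mu (phi i))%N.
have [m] := ubnP (b - mu (phi i)); elim: m i => // m IH i; rewrite ltnS => le is_.
have := congr1 (mcoeff (phi i)) sum0; rewrite raddf_sum mcoeff0 (big_rem _ is_) /=.
rewrite mcoeffZ G_diag mulr1 big_seq big1 ?addr0 // => j.
rewrite mem_rem_uniq // inE => /andP[ji js]; rewrite mcoeffZ.
have [->|nz] := eqVneq (G (phi j))@_(phi i) 0; first by rewrite mulr0.
have nij : phi i != phi j by apply: contraNneq ji => e; apply/eqP/inj.
have lt := G_low nz nij.
have : (mu (phi j) <= b)%N by apply: leq_bigmax_seq.
by move=> le_b; rewrite IH ?mul0r //; lia.
Qed.

End Triangular.

(** In [freely_generated] a coefficient is a function of the word, so the repetitions in a list of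
    pairs must be merged. *)
Lemma sum_pairs_uniq (K : fieldType) (V : lmodType K) (I : eqType)
    (L : seq (K * I)) (f : I -> V) :
  \sum_(p <- L) p.1 *: f p.2 =
  \sum_(i <- undup [seq p.2 | p <- L]) (\sum_(p <- L | p.2 == i) p.1) *: f i.
Proof.
under [RHS]eq_bigr do rewrite scaler_suml.
rewrite (exchange_big_dep xpredT) //= big_seq [RHS]big_seq.
apply: eq_bigr => p pL; under [RHS]eq_bigl do rewrite eq_sym.
by rewrite -big_filter filter_pred1_uniq ?undup_uniq ?big_seq1 // mem_undup map_f.
Qed.

(** * Entries of block matrices *)

Section Raw.
Variable k : nat.
Local Notation mat n := 'M['I_k.+1]_n.
Local Notation raw := (Tagged (fun n => mat n)).
Implicit Types M N : rawmat k.

Definition nzrows n (A : mat n) : Prop := forall i, exists j, A i j != 0.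

Lemma packedP n (A : mat n) : reflect (nzrows A /\ nzcols A) (packedb (raw A)).
Proof.
apply: (iffP andP) => /= -[].
  by move=> /forallP r /forallP c; split=> i; [have /existsP[j nz] := r i|
    have /existsP[j nz] := c i]; exists j; rewrite -val_eqE.
move=> r c; split; apply/forallP => i; apply/existsP; [have [j nz] := r i|
    have [j nz] := c i]; by exists j; rewrite -val_eqE in nz.
Qed.

Lemma nzrows_perm n (s : 'S_n) (A : mat n) : nzrows A -> nzrows (col_perm s A).
Proof.
by move=> nzA i; have [j Aij] := nzA i; exists (s^-1 j)%g; rewrite mxE permKV.
Qed.

Lemma packed_perm n (s : 'S_n) (A : mat n) :
  packedb (raw A) -> packedb (raw (col_perm s A)).
Proof.
move=> /packedP[r c]; apply/packedP; split; first exact: nzrows_perm.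
exact: nzcols_perm.
Qed.

Lemma leM_packed n (A B : mat n) :
  leM A B -> packedb (raw A) -> packedb (raw B).
Proof.
move=> /connectP[p]; elim: p A => [|C p IH] A /=; first by move=> _ ->.
case/andP=> /arrowP[i [j [_ _ ->]]] pth lst pA.
exact: IH _ pth lst (packed_perm _ pA).
Qed.

Lemma rawI n : injective (fun A : mat n => raw A).
Proof. by move=> A B /eqP; rewrite eq_Tagged => /eqP. Qed.

(** Distinct permutations may give the same matrix. Both sides count each matrix once, by [undup] on
    the left and by the existential in [is_shuffle] on the right. *)
Lemma sum_shc n1 n2 (A : mat n1) (B : mat n2) (V : nmodType) (F : rawmat k -> V) :
  \sum_(N <- shc (raw A) (raw B)) F N =
  \sum_(C | is_shuffle A B C) F (raw C).
Proof.
have <- : \sum_(N <- [seq raw C | C in is_shuffle A B]) F N =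
          \sum_(C | is_shuffle A B C) F (raw C) by rewrite big_image.
apply: perm_big; apply: uniq_perm; first exact: undup_uniq.
  by rewrite map_inj_uniq ?enum_uniq //; apply: rawI.
move=> N; rewrite mem_undup; apply/mapP/mapP => -[].
  move=> s; rewrite mem_enum inE => sh ->.
  exists (col_perm s (dsum A B)); last by rewrite /dsum block_mxEh.
  by rewrite mem_enum; apply/is_shuffleP; exists s.
move=> C; rewrite mem_enum => /is_shuffleP[s sh ->] ->.
by exists s; rewrite ?mem_enum // /dsum block_mxEh.
Qed.

(* Entries indexed by [nat] ([0] outside the matrix), so that matrices whose sizes
   are only propositionally equal can be compared without casts. *)
Definition ent M (i j : nat) : nat :=
  if insub i is Some a then if insub j is Some b then tagged M a b : nat else 0%N
  else 0%N.

Lemma ent_ord n (A : mat n) (i j : 'I_n) : ent (raw A) i j = A i j.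
Proof. by rewrite /ent !valK. Qed.

Lemma ent_outl M i j : (rsize M <= i)%N -> ent M i j = 0%N.
Proof. by move=> le; rewrite /ent insubF //; apply/negbTE; rewrite -leqNgt. Qed.

Lemma ent_outr M i j : (rsize M <= j)%N -> ent M i j = 0%N.
Proof.
move=> le; rewrite /ent; case: insubP => // *.
by rewrite insubF //; apply/negbTE; rewrite -leqNgt.
Qed.

Lemma ent_le M i j : (ent M i j <= k)%N.
Proof. by rewrite /ent; do 2?case: insubP => // *; rewrite -ltnS. Qed.

Lemma ent_inj M N : rsize M = rsize N ->
  (forall i j, (i < rsize N)%N -> (j < rsize N)%N -> ent M i j = ent N i j) ->
  M = N.
Proof.
case: M N => [n A] [m B]; rewrite /rsize /= => e; case: _ / e B => B eqe.
congr existT; apply/matrixP => i j; apply: val_inj.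
by rewrite /= -!ent_ord; apply: eqe.
Qed.

Lemma packed_entP M :
  reflect ((forall i, (i < rsize M)%N -> exists j, ent M i j != 0%N) /\
           (forall j, (j < rsize M)%N -> exists i, ent M i j != 0%N)) (packedb M).
Proof.
case: M => n A; apply: (iffP (packedP A)) => -[r c]; split.
- by move=> i lt; have [j nz] := r (Ordinal lt); exists j;
    rewrite -[i]/(val (Ordinal lt)) ent_ord.
- by move=> j lt; have [i nz] := c (Ordinal lt); exists i;
    rewrite -[j]/(val (Ordinal lt)) ent_ord.
- move=> i; have [j nz] := r i (ltn_ord i).
  have lt : (j < n)%N by rewrite ltnNge; apply: contraNN nz => le; rewrite ent_outr.
  by exists (Ordinal lt); rewrite -val_eqE /= -ent_ord.
- move=> j; have [i nz] := c j (ltn_ord j).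
  have lt : (i < n)%N by rewrite ltnNge; apply: contraNN nz => le; rewrite ent_outl.
  by exists (Ordinal lt); rewrite -val_eqE /= -ent_ord.
Qed.

Lemma rsize_ov M N : rsize (ov M N) = (rsize M + rsize N)%N. Proof. by []. Qed.

(** The upper right block needs no test, because [ent M] vanishes outside [M]. The lower left one
    does: truncated subtraction would otherwise read column [0] of [N]. *)
Lemma ent_ov M N i j : ent (ov M N) i j =
  if (i < rsize M)%N then ent M i j
  else if (j < rsize M)%N then 0%N else ent N (i - rsize M) (j - rsize M).
Proof.
case: M N => [n A] [m B]; rewrite /rsize /=.
have [ii|ii] := leqP (n + m) i.
  rewrite ent_outl // ifF; last by apply/negbTE; lia.
  by case: ifP => // _; rewrite ent_outl //= /rsize /=; lia.
have [jj|jj] := leqP (n + m) j.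
  rewrite ent_outr //; case: ifP => _; first by rewrite ent_outr //= /rsize /=; lia.
  by case: ifP => // _; rewrite ent_outr //= /rsize /=; lia.
rewrite -[i]/(val (Ordinal ii)) -[j]/(val (Ordinal jj)) ent_ord.
case: (split_ordP (Ordinal ii)) => a ->; case: (split_ordP (Ordinal jj)) => b ->;
  rewrite ?block_mxEul ?block_mxEur ?block_mxEdl ?block_mxEdr /= ?mxE.
- by rewrite ent_ord.
- by rewrite ent_outr //= /rsize /=; lia.
- by [].
- by rewrite !addKn ent_ord.
Qed.

Lemma ent_un M N i j : ent (un M N) i j =
  if (i < rsize M)%N then if (j < rsize N)%N then 0%N else ent M i (j - rsize N)
  else ent N (i - rsize M) j.
Proof.
case: M N => [n A] [m B]; rewrite /rsize /=.
have [ii|ii] := leqP (n + m) i.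
  rewrite ent_outl // ifF; last by apply/negbTE; lia.
  by rewrite ent_outl //= /rsize /=; lia.
have [jj|jj] := leqP (n + m) j.
  rewrite ent_outr //; case: ifP => _; last by rewrite ent_outr //= /rsize /=; lia.
  by case: ifP => // _; rewrite ent_outr //= /rsize /=; lia.
rewrite -[i]/(val (Ordinal ii)) -[j]/(val (Ordinal jj)) ent_ord castmxE cast_ord_id.
set c := cast_ord _ (Ordinal jj).
have -> : val (Ordinal jj) = val c by [].
case: (split_ordP (Ordinal ii)) => a ->; case: (split_ordP c) => b ->;
  rewrite ?block_mxEul ?block_mxEur ?block_mxEdl ?block_mxEdr /= ?mxE.
- by [].
- by rewrite addKn ent_ord.
- by rewrite addKn ent_ord.
- by rewrite addKn ent_outr //= /rsize /=; lia.
Qed.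

End Raw.

(** * Unique factorization for the over operation *)

Section Factorization.
Variable k : nat.
Local Notation mat n := 'M['I_k.+1]_n.
Local Notation raw := (Tagged (fun n => mat n)).
Implicit Types M N X : rawmat k.

Lemma packed_ov M N : packedb M -> packedb N -> packedb (ov M N).
Proof.
move=> /packed_entP[rM cM] /packed_entP[rN cN].
apply/packed_entP; rewrite rsize_ov; split=> i lt.
  have [ltM|geM] := ltnP i (rsize M).
    by have [j nz] := rM i ltM; exists j; rewrite ent_ov ltM.
  have [|j nz] := rN (i - rsize M)%N; first by lia.
  by exists (rsize M + j)%N; rewrite ent_ov !ltnNge geM leq_addr /= addKn.
have [ltM|geM] := ltnP i (rsize M).
  have [j nz] := cM i ltM; exists j; rewrite ent_ov ifT // ltnNge.
  by apply: contraNN nz => le; rewrite ent_outl.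
have [|j nz] := cN (i - rsize M)%N; first by lia.
by exists (rsize M + j)%N; rewrite ent_ov !ltnNge geM leq_addr /= addKn.
Qed.

(** Rows and columns through the block of [N] vanish outside it, so their nonzero entries lie in
    [N]. This makes the factor produced by [ov_split] packed. *)
Lemma packed_ovr M N : packedb (ov M N) -> packedb N.
Proof.
move=> /packed_entP[r c]; apply/packed_entP; split=> i lt.
  have [|j] := r (rsize M + i)%N; first by rewrite rsize_ov ltn_add2l.
  rewrite ent_ov ltnNge leq_addr /= addKn; case: ifP => // _ nz.
  by exists (j - rsize M)%N.
have [|j] := c (rsize M + i)%N; first by rewrite rsize_ov ltn_add2l.
rewrite ent_ov (ltnNge (_ + i)) leq_addr /= addKn.
case: ifP => _; first by rewrite ent_outr ?eqxx ?leq_addr.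
by exists (j - rsize M)%N.
Qed.

Lemma packed_empty : packedb (pk_empty k).
Proof. by apply/packedP; split=> -[]. Qed.

Lemma rsize0 M : rsize M = 0%N -> M = pk_empty k.
Proof. by move=> e; apply: ent_inj. Qed.

Lemma ov0r M : ov M (pk_empty k) = M.
Proof.
apply: ent_inj; first by rewrite rsize_ov addn0.
by move=> i j lti ltj; rewrite ent_ov lti.
Qed.

Lemma ov0l M : ov (pk_empty k) M = M.
Proof. by apply: ent_inj => // i j _ _; rewrite ent_ov /= !subn0. Qed.

Lemma ovA M N X : ov M (ov N X) = ov (ov M N) X.
Proof.
apply: ent_inj; first by rewrite !rsize_ov addnA.
move=> i j _ _; rewrite !ent_ov !rsize_ov !subnDA.
case: ltnP => im; first by rewrite ltn_addr.
have -> : (i - rsize M < rsize N)%N = (i < rsize M + rsize N)%N by lia.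
case: (ltnP j) => jm.
  by case: ifP => // _; rewrite ltn_addr.
by have -> : (j - rsize M < rsize N)%N = (j < rsize M + rsize N)%N by lia.
Qed.

(** The analogue of Levi's lemma for words. [X] is the lower right corner of [M']; the off-diagonal
    parts of [M'] vanish because [ov M N] is zero there. *)
Lemma ov_split M N M' N' : ov M N = ov M' N' -> (rsize M <= rsize M')%N ->
  exists2 X, M' = ov M X & rsize X = (rsize M' - rsize M)%N.
Proof.
move=> e le; pose f i j := ent M' (rsize M + i) (rsize M + j).
pose X : rawmat k := raw (\matrix_(i < rsize M' - rsize M, j < rsize M' - rsize M)
  inord (f i j)).
have entX i j : (i < rsize X)%N -> (j < rsize X)%N -> ent X i j = f i j.
  move=> ii jj; rewrite -[i]/(val (Ordinal ii)) -[j]/(val (Ordinal jj)) ent_ord mxE.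
  by rewrite inordK // ltnS ent_le.
exists X => //; apply: ent_inj; first by rewrite rsize_ov /rsize /= subnKC.
rewrite rsize_ov {1 2}/rsize /= subnKC // => i j ii jj.
have := congr1 (fun Y => ent Y i j) e; rewrite !ent_ov.
have [_|ge_i] := ltnP i (rsize M); first by rewrite ifT //; lia.
rewrite ii; have [//|ge_j] := ltnP j (rsize M).
move=> _; have sX : rsize X = (rsize M' - rsize M)%N by [].
by rewrite entX ?sX /f ?subnKC //; lia.
Qed.

Lemma ov_cancel M N M' N' : ov M N = ov M' N' -> rsize M = rsize M' ->
  M = M' /\ N = N'.
Proof.
move=> e eqM; have eqN : rsize N = rsize N'.
  by have := congr1 (@rsize k) e; rewrite !rsize_ov eqM; lia.
split; apply: ent_inj => // i j ii jj.
  have := congr1 (fun Y => ent Y i j) e.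
  by rewrite /= !ent_ov eqM ii.
have := congr1 (fun Y => ent Y (rsize M + i)%N (rsize M + j)%N) e.
by rewrite /= !ent_ov eqM !ltnNge !leq_addr /= !addKn.
Qed.

Definition ovp (M N : pk k) : pk k :=
  exist _ (ov (val M) (val N)) (packed_ov (valP M) (valP N)).

Definition emptyp : pk k := exist _ (pk_empty k) packed_empty.

Definition ovprod (w : seq (pk k)) : pk k := foldr ovp emptyp w.

(** If the first factors had different sizes, the longer would split off the shorter by [ov_split].
    Connectedness would then force equal sizes or an empty factor. *)
Lemma connected_ov_inj (M N M' N' : pk k) : connected M -> connected M' ->
  ovp M N = ovp M' N' -> M = M' /\ N = N'.
Proof.
move=> cM cM' /(congr1 val) /=.
wlog le : M N M' N' cM cM' / (rsize (val M) <= rsize (val M'))%N.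
  move=> wl e; case: (leqP (rsize (val M)) (rsize (val M'))) => [le|/ltnW le].
    exact: wl.
  by have [-> ->] := wl _ _ _ _ cM' cM le (esym e).
move=> e; move: le; rewrite leq_eqVlt => /orP[/eqP eqM|lt].
  by have [eM eN] := ov_cancel e eqM; split; apply: val_inj.
have [X eX sX] := ov_split e (ltnW lt).
have pX : packedb X by apply: (@packed_ovr (val M)); rewrite -eX; apply: valP.
have [MM|XM] := cM'.2 M (exist _ X pX) eX.
  by move: lt; rewrite MM ltnn.
by have := cM.1; move: sX lt; rewrite -XM /=; lia.
Qed.

Definition all_in (P : pk k -> Prop) (w : seq (pk k)) : Prop :=
  forall M : pk k, M \in w -> P M.

Lemma ovprod_inj w w' : all_in (@connected k) w -> all_in (@connected k) w' ->
  ovprod w = ovprod w' -> w = w'.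
Proof.
elim: w w' => [|M w IH] [|M' w'] // c c'.
- have [lt _] := c' M' (mem_head _ _).
  by move/(congr1 (fun Y => rsize (val Y))); move: lt; rewrite /rsize /=; lia.
- have [lt _] := c M (mem_head _ _).
  by move/(congr1 (fun Y => rsize (val Y))); move: lt; rewrite /rsize /=; lia.
move=> /= /connected_ov_inj[||-> /IH ->] //; try (by move=> Y Yw; apply: c; rewrite inE Yw orbT);
  try (by move=> Y Yw; apply: c'; rewrite inE Yw orbT).
- exact: c (mem_head _ _).
- exact: c' (mem_head _ _).
Qed.

Lemma ovprod_cat w w' : ovprod (w ++ w') = ovp (ovprod w) (ovprod w').
Proof.
elim: w => [|M w IH]; apply: val_inj => /=; first by rewrite ov0l.
by rewrite IH /= ovA.
Qed.

Lemma ovprod_surj (M : pk k) : exists2 w, all_in (@connected k) w & ovprod w = M.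
Proof.
have [m] := ubnP (rsize (val M)); elim: m M => // m IH M; rewrite ltnS => le.
have [/rsize0 e|pos] := posnP (rsize (val M)).
  by exists [::] => //; apply: val_inj.
(* Connectedness is a proposition quantified over all packed pairs, hence the classical case
   split. *)
have [[A [B [e nA nB]]]|no] :=
    classic (exists A B : pk k, [/\ val M = ov (val A) (val B), A <> M & B <> M]).
  have sz : rsize (val M) = (rsize (val A) + rsize (val B))%N by rewrite e.
  (* An empty factor would make the other equal to [M], so both are strictly smaller than [M]. *)
  have pA : rsize (val A) <> 0%N.
    by move=> /rsize0 z; apply: nB; apply: val_inj; rewrite e z ov0l.
  have pB : rsize (val B) <> 0%N.
    by move=> /rsize0 z; apply: nA; apply: val_inj; rewrite e z ov0r.
  have [|v cv ev] := IH A; first by lia.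
  have [|w cw ew] := IH B; first by lia.
  exists (v ++ w); last by rewrite ovprod_cat ev ew; apply: val_inj.
  by move=> Y; rewrite mem_cat => /orP[/cv|/cw].
exists [:: M]; last by apply: val_inj; rewrite /= ov0r.
move=> Y; rewrite inE => /eqP ->; split=> // A B e.
apply: NNPP => neg; apply: no; exists A, B.
by split=> // eAB; apply: neg; [left|right].
Qed.

End Factorization.

(** * The E basis, and column reversal *)

Section EBasis.
Variables (K : fieldType) (k : nat).
Local Notation mat n := 'M['I_k.+1]_n.
Local Notation raw := (Tagged (fun n => mat n)).
Local Notation F := (Fraw K).
Implicit Types M N : pk k.

Lemma raw_tagged (M : rawmat k) : raw (tagged M) = M.
Proof. by case: M. Qed.

Lemma Fraw_val M : F (val M) = << M >>.
Proof. by rewrite /Fraw valK. Qed.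

Lemma Fraw_packed (N : rawmat k) (p : packedb N) : F N = << exist _ N p >>.
Proof. exact: (Fraw_val (exist _ N p)). Qed.

Lemma mcoeff_Fraw (N : rawmat k) M : (F N)@_M = (N == val M)%:R.
Proof.
rewrite /Fraw; case: insubP => [M' _ <-|nN]; first by rewrite mcoeffU val_eqE.
by rewrite mcoeff0; case: eqP => // e; move: nN; rewrite e (valP M).
Qed.

Definition mulF M N : PM K k := \sum_(X <- shc (val M) (val N)) F X.

Lemma mulPM_lext (x y : PM K k) :
  mulPM x y = lext (fun M => lext (mulF M) y) x.
Proof.
rewrite /mulPM /lext; apply: eq_bigr => M _; rewrite scaler_sumr.
by apply: eq_bigr => N _; rewrite scalerA.
Qed.

Lemma mulPM_suml (I : finType) (P : pred I) (f : I -> PM K k) y :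
  mulPM (\sum_(i | P i) f i) y = \sum_(i | P i) mulPM (f i) y.
Proof. by rewrite mulPM_lext linear_sum; apply: eq_bigr => i _; rewrite mulPM_lext. Qed.

Lemma mulPM_sumr (I : finType) (P : pred I) (f : I -> PM K k) M :
  mulPM << M >> (\sum_(i | P i) f i) = \sum_(i | P i) mulPM << M >> (f i).
Proof.
rewrite mulPM_lext lextU linear_sum; apply: eq_bigr => i _.
by rewrite mulPM_lext lextU.
Qed.

Lemma mulPM_basis M N : mulPM << M >> << N >> = mulF M N.
Proof. by rewrite mulPM_lext !lextU. Qed.

Lemma leM_pk_packed M B : leM (tagged (val M)) B -> packedb (raw B).
Proof. by move=> le; apply: leM_packed le _; rewrite raw_tagged valP. Qed.

Lemma nzcols_pk M : nzcols (tagged (val M)).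
Proof. by case: M => -[n A] p /=; have /packedP[] := p. Qed.

(** [sum_leM_dsum] groups the terms of the right side into shuffles of [B] and [X], and each group
    is a product of two basis vectors. *)
Lemma EPM_mul M N : mulPM (EPM K M) (EPM K N) = EPM K (ovp M N).
Proof.
rewrite {3}/EPM /= -/(dsum _ _).
rewrite (sum_leM_dsum (fun C => F (raw C)) (@nzcols_pk M) (@nzcols_pk N)).
rewrite mulPM_suml; apply: eq_bigr => B /leM_pk_packed pB.
rewrite (Fraw_packed pB) mulPM_sumr; apply: eq_bigr => X /leM_pk_packed pX.
by rewrite (Fraw_packed pX) mulPM_basis /mulF /= sum_shc.
Qed.

Lemma EPM_empty : EPM K (emptyp k) = onePM K k.
Proof.
rewrite /EPM (big_pred1 (0 : mat 0)) // => B.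
by rewrite /= [B]flatmx0 eqxx leM_refl.
Qed.

Lemma monom_EPM (w : seq (pk k)) : monom (@EPM K k) w = EPM K (ovprod w).
Proof.
elim: w => [|M w IH]; first by rewrite EPM_empty.
by rewrite [LHS]/= -EPM_mul -IH.
Qed.

Lemma EPM_diag M : (EPM K M)@_M = 1.
Proof.
rewrite /EPM raddf_sum (bigD1 (tagged (val M))) ?leM_refl //= big1 ?addr0.
  by rewrite mcoeff_Fraw raw_tagged eqxx.
move=> B /andP[_ nB]; rewrite mcoeff_Fraw; case: eqP => // e; case/eqP: nB.
by apply: (@rawI k); rewrite e raw_tagged.
Qed.

Definition pkweight M : nat := colweight (tagged (val M)).

Lemma EPM_low M N : (EPM K M)@_N != 0 -> N != M -> (pkweight N < pkweight M)%N.
Proof.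
move=> nz NM; have [B le e] : exists2 B, leM (tagged (val M)) B & raw B = val N.
  have [/existsP[B /andP[le /eqP e]]|] :=
    boolP [exists B, leM (tagged (val M)) B && (raw B == val N)]; first by exists B.
  rewrite negb_exists => /forallP no; case/eqP: nz.
  rewrite /EPM raddf_sum big1 // => B le /=; rewrite mcoeff_Fraw.
  by move: (no B); rewrite le /= => /negbTE ->.
have wN : pkweight N = colweight B by rewrite /pkweight -e.
rewrite wN; case: (leM_colweight (@nzcols_pk M) le) => // eB.
by case/eqP: NM; apply: val_inj; rewrite -e eB raw_tagged.
Qed.

Lemma EPM_free : freely_generated (@EPM K k) (@connected k).
Proof.
split=> [x|s c us conn sum0 w ws].
  have [L ->] := triangular_span EPM_diag EPM_low x.
  have [L' [conn ->]] : exists L' : seq (K * seq (pk k)),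
    (forall p, p \in L' -> all_in (@connected k) p.2) /\
    \sum_(p <- L) p.1 *: EPM K p.2 = \sum_(p <- L') p.1 *: monom (@EPM K k) p.2.
    elim: L => [|[a M] L [L' [conn IH]]]; first by exists [::]; rewrite !big_nil.
    have [w cw ew] := ovprod_surj M; exists ((a, w) :: L'); split.
      by move=> p; rewrite inE => /orP[/eqP -> //|/conn].
    by rewrite !big_cons IH /= monom_EPM ew.
  rewrite sum_pairs_uniq.
  exists (undup [seq p.2 | p <- L']), (fun w => \sum_(p <- L' | p.2 == w) p.1).
  split=> // w; rewrite mem_undup => /mapP[p pL ->]; exact: conn.
(* A word stands for its over-product, and [ovprod_inj] makes this faithful on words of connected
   matrices. *)
apply: (triangular_free EPM_diag EPM_low us (phi := @ovprod k) _ _ ws).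
  by move=> v v' vs v's; apply: ovprod_inj; apply: conn.
by rewrite -[RHS]sum0; apply: eq_bigr => v _; rewrite monom_EPM.
Qed.

End EBasis.

(* Reversing the order of the columns reverses [leM], exchanges [ov] and [un], and
   induces an automorphism [rho] with [HPM M = rho (EPM (revp M))]: the claim for
   the [HPM] follows from the one for the [EPM]. *)
Section Reversal.
Variables (K : fieldType) (k : nat).
Local Notation mat n := 'M['I_k.+1]_n.
Local Notation raw := (Tagged (fun n => mat n)).
Local Notation F := (Fraw K).

Definition rev_perm n : 'S_n := perm (@rev_ord_inj n).

Lemma rev_permE n (i : 'I_n) : rev_perm n i = rev_ord i.
Proof. exact: permE. Qed.

Definition revmx n (A : mat n) : mat n := col_perm (rev_perm n) A.

Lemma revmxE n (A : mat n) i j : revmx A i j = A i (rev_ord j).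
Proof. by rewrite mxE rev_permE. Qed.

Lemma revmxK n : involutive (@revmx n).
Proof. by move=> A; apply/matrixP => i j; rewrite !revmxE rev_ordK. Qed.

(** After an exchange the column with the upper entries is on the right. The mirror brings it back
    to the left, so the same pair can be exchanged in the mirrored matrix. *)
Lemma arrow_rev n (A B : mat n) : arrow A B -> arrow (revmx B) (revmx A).
Proof.
move=> /arrowP[i [j [ji sep ->]]]; apply/arrowP; exists (rev_ord j), (rev_ord i).
split.
- by have := ltn_ord j; rewrite /= ji; lia.
- by move=> r r'; rewrite !revmxE !col_permEp !rev_ordK tpermL tpermR; apply: sep.
apply/matrixP => r c; rewrite revmxE col_permEp revmxE col_permEp.
by rewrite (inj_tperm _ _ _ (@rev_ord_inj n)) !rev_ordK [tperm j i]tpermC tpermK.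
Qed.

Lemma leM_rev n (A B : mat n) : leM (revmx B) (revmx A) = leM A B.
Proof.
have imp (C D : mat n) : leM C D -> leM (revmx D) (revmx C).
  move=> /connectP[p]; elim: p C => [|X p IH] C /=; first by move=> _ ->; apply: leM_refl.
  case/andP=> /arrow_rev CX pth lst; apply: leM_trans (IH _ pth lst) _.
  exact: connect1.
by apply/idP/idP => /imp //; rewrite !revmxK.
Qed.

Lemma shuffle_rev n1 n2 (A : mat n1) (B : mat n2) C :
  is_shuffle (revmx A) (revmx B) (revmx C) = is_shuffle A B C.
Proof.
have imp (A' : mat n1) (B' : mat n2) C' : is_shuffle A' B' C' ->
    is_shuffle (revmx A') (revmx B') (revmx C').
  move=> /is_shuffleP[s /shufflepP sh ->].
  (* [t0] reverses each block separately, matching [revmx A'] and [revmx B']. Composed with the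
     reversal of positions, the two order reversals cancel inside each block. *)
  pose t0 (x : 'I_(n1 + n2)) : 'I_(n1 + n2) :=
    match split x with inl a => lshift n2 (rev_ord a) | inr b => rshift n1 (rev_ord b) end.
  have t0l a : t0 (lshift n2 a) = lshift n2 (rev_ord a).
    by rewrite /t0 (unsplitK (inl a)).
  have t0r b : t0 (rshift n1 b) = rshift n1 (rev_ord b).
    by rewrite /t0 (unsplitK (inr b)).
  have t0K : involutive t0.
    by move=> x; case: (split_ordP x) => a ->; rewrite ?t0l ?t0r rev_ordK.
  have t0lt x : (t0 x < n1)%N = (x < n1)%N.
    by case: (split_ordP x) => a ->; rewrite ?t0l ?t0r /=; have := ltn_ord a; lia.
  have t0anti (x y : 'I_(n1 + n2)) : (x < n1)%N = (y < n1)%N -> (x < y)%N -> (t0 y < t0 x)%N.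
    case: (split_ordP x) => a ->; case: (split_ordP y) => b ->;
      rewrite ?t0l ?t0r /=; have := ltn_ord a; have := ltn_ord b; lia.
  pose t := perm (inv_inj t0K).
  apply/is_shuffleP; exists (rev_perm _ * s * t)%g.
    apply/shufflepP => x y xy; rewrite !permM !(permE (inv_inj t0K)) !t0lt => e.
    apply: t0anti; first by rewrite e.
    apply: sh; last by rewrite e.
    by rewrite !permE /=; have := ltn_ord y; lia.
  apply/matrixP => r c; rewrite revmxE !col_permEp !permM rev_permE.
  rewrite (permE (inv_inj t0K)); move: (s (rev_ord c)) => y.
  case: (split_ordP y) => a ->; rewrite ?t0l ?t0r;
  case: (split_ordP r) => b ->;
  by rewrite /dsum ?block_mxEul ?block_mxEur ?block_mxEdl ?block_mxEdr ?revmxE ?rev_ordK // !mxE.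
by apply/idP/idP => /imp //; rewrite !revmxK.
Qed.

Definition revr (M : rawmat k) : rawmat k := raw (revmx (tagged M)).

Lemma revrK : involutive revr.
Proof. by move=> [n A]; rewrite /revr /= revmxK. Qed.

Lemma packed_rev (M : rawmat k) : packedb M -> packedb (revr M).
Proof. by case: M => n A; apply: packed_perm. Qed.

Definition revp (M : pk k) : pk k := exist _ (revr (val M)) (packed_rev (valP M)).

Lemma revpK : involutive revp.
Proof. by move=> M; apply: val_inj; rewrite /= revrK. Qed.

Lemma ent_rev (M : rawmat k) i j : (j < rsize M)%N ->
  ent (revr M) i j = ent M i (rsize M - j.+1).
Proof.
case: M => n A; rewrite /rsize /= => lt.
have [lti|ge] := ltnP i n; last by rewrite !ent_outl.
rewrite -[j]/(val (Ordinal lt)) -[i]/(val (Ordinal lti)) ent_ord revmxE.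
by rewrite -ent_ord.
Qed.

Lemma rev_ov (M N : rawmat k) : revr (ov M N) = un (revr M) (revr N).
Proof.
apply: ent_inj => // i j.
have sM : rsize (revr M) = rsize M by [].
have sN : rsize (revr N) = rsize N by [].
have -> : rsize (un (revr M) (revr N)) = (rsize M + rsize N)%N by [].
move=> lti ltj; rewrite ent_rev ?rsize_ov // ent_ov ent_un sM sN.
have [ltM|geM] := ltnP i (rsize M); have [ltN|geN] := ltnP j (rsize N).
- by rewrite ent_outr //; lia.
- by rewrite ent_rev; [congr ent; lia|lia].
- by rewrite ifF; [rewrite ent_rev //; congr ent; lia|lia].
- by rewrite ifT; [rewrite ent_outr|lia].
Qed.

Lemma rev_un (M N : rawmat k) : revr (un M N) = ov (revr M) (revr N).
Proof. by rewrite -{1}(revrK M) -{1}(revrK N) -rev_ov revrK. Qed.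

Lemma anticonnected_rev (M : pk k) : anticonnected M -> connected (revp M).
Proof.
move=> [pos anti]; split=> // A B e.
have [|eA|eB] := anti (revp A) (revp B).
- by rewrite /= -rev_ov -e revrK.
- by left; rewrite -eA revpK.
- by right; rewrite -eB revpK.
Qed.

Lemma connected_rev (M : pk k) : connected M -> anticonnected (revp M).
Proof.
move=> [pos conn]; split=> // A B e.
have [|eA|eB] := conn (revp A) (revp B).
- by rewrite /= -rev_un -e revrK.
- by left; rewrite -eA revpK.
- by right; rewrite -eB revpK.
Qed.

Definition rho : PM K k -> PM K k := lext (fun M => << revp M >>).
HB.instance Definition _ := GRing.Linear.on rho.

Lemma rhoU M : rho << M >> = << revp M >>. Proof. exact: lextU. Qed.

Lemma rho_Fraw (N : rawmat k) : rho (F N) = F (revr N).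
Proof.
have [pN|nN] := boolP (packedb N).
  by rewrite (Fraw_packed K pN) rhoU -Fraw_val.
rewrite /Fraw !insubF ?linear0 //; last exact: negbTE.
by apply: contraNF nN => /packed_rev; rewrite revrK.
Qed.

Lemma rho_lext (f : pk k -> PM K k) x :
  rho (lext f x) = lext (fun M => rho (f M)) x.
Proof. exact: lext_lext. Qed.

Lemma lext_rho (f : pk k -> PM K k) x :
  lext f (rho x) = lext (fun M => f (revp M)) x.
Proof. by rewrite /rho lext_lext; apply: eq_lext => M; apply: lextU. Qed.

Lemma rhoK : involutive rho.
Proof.
move=> x; rewrite {1}/rho lext_rho [RHS]malg_lext.
by apply: eq_lext => M; rewrite revpK.
Qed.

Lemma rho_mulF M N : rho (mulF K M N) = mulF K (revp M) (revp N).
Proof.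
case: M N => -[n1 A] pA [[n2 B] pB].
rewrite /mulF /revr /= !sum_shc linear_sum /=.
rewrite [RHS](reindex_inj (inv_inj (@revmxK _))) /=.
apply: eq_big => C; first by rewrite shuffle_rev.
by rewrite rho_Fraw.
Qed.

Lemma rho_mul x y : rho (mulPM x y) = mulPM (rho x) (rho y).
Proof.
transitivity (lext (fun M => rho (lext (mulF K M) y)) x).
  by rewrite mulPM_lext; exact: rho_lext.
transitivity (lext (fun M => lext (mulF K (revp M)) (rho y)) x).
  apply: eq_lext => M; rewrite [LHS]rho_lext [RHS]lext_rho.
  by apply: eq_lext => N; apply: rho_mulF.
by rewrite [RHS]mulPM_lext [RHS]lext_rho.
Qed.

(** By [leM_rev], the mirror carries the matrices below [M] to those above [revp M]. *)
Lemma HPM_rho M : HPM K M = rho (EPM K (revp M)).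
Proof.
case: M => -[n A] p; rewrite /HPM /EPM linear_sum /=.
rewrite (reindex_inj (inv_inj (@revmxK _))); apply: eq_big => B.
  by rewrite -leM_rev revmxK.
by rewrite rho_Fraw.
Qed.

Lemma rho_one : rho (onePM K k) = onePM K k.
Proof. by rewrite /onePM rho_Fraw; congr F; apply: rsize0. Qed.

Lemma monom_HPM w : monom (@HPM K k) w = rho (monom (@EPM K k) (map revp w)).
Proof.
elim: w => [|M w IH]; first by rewrite [RHS]rho_one.
rewrite -[LHS]/(mulPM (HPM K M) (monom (@HPM K k) w)) IH HPM_rho.
exact: esym (rho_mul _ _).
Qed.

Lemma HPM_free : freely_generated (@HPM K k) (@anticonnected k).
Proof.
have [span free] := EPM_free K k.
have mapK : involutive (map revp) by move=> w; rewrite mapK //; apply: revpK.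
split=> [x|s c us anti sum0 w ws].
  (* Expand [rho x] in E-monomials, then return to [x] with the involution [rho]. *)
  have [s [c [conn e]]] := span (rho x).
  exists (map (map revp) s), (fun w => c (map revp w)); split.
    move=> w /mapP[v vs ->] M /mapP[N Nv ->].
    exact: connected_rev (conn v vs N Nv).
  rewrite -[x]rhoK e linear_sum big_map; apply: eq_bigr => w _.
  by rewrite linearZ /= monom_HPM !mapK.
rewrite -[w]mapK.
apply: (free (map (map revp) s) (fun w => c (map revp w))).
- by rewrite map_inj_uniq //; apply: inv_inj.
- move=> _ /mapP[v vs ->] _ /mapP[N Nv ->].
  exact: anticonnected_rev (anti v vs N Nv).
- apply: (inv_inj rhoK); rewrite linear0 -[RHS]sum0 linear_sum big_map.
  by apply: eq_bigr => v _; rewrite linearZ /= mapK monom_HPM.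
- exact: map_f.
Qed.

End Reversal.

Theorem theorem2p4 (K : fieldType) (k : nat) :
  [pchar K] =i pred0 -> (0 < k)%N ->
  freely_generated (@EPM K k) (@connected k) /\
  freely_generated (@HPM K k) (@anticonnected k).
Proof. by move=> _ _; split; [exact: EPM_free | exact: HPM_free]. Qed.
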